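(* Let $c\in\{0,N\}$ and let $C$ be an $(N+1)d\times(N+1)d$ positive definite block matrix (with $N+1$ blocks in each row/column, each block being $d\times d$). Then $C^{-1}$ is a $CM_c$ matrix if and only if $$C=B+\Gamma D\Gamma'$$ for some $d\times d$ positive definite matrix $D$ and some $B,\Gamma$ of the following form: (i) if $c=N$, then $B=\begin{bmatrix} B_1 & 0 \\ 0 & 0 \end{bmatrix}$ and $\Gamma=\begin{bmatrix} S \\ I \end{bmatrix}$; (ii) if $c=0$, then $B=\begin{bmatrix} 0 & 0 \\ 0 & B_1 \end{bmatrix}$ and $\Gamma=\begin{bmatrix} I \\ S \end{bmatrix}$, where $(B_1)^{-1}$ is an $Nd\times Nd$ block tri-diagonal matrix, $S$ is an $Nd\times d$ matrix, and $I$ is the $d\times d$ identity matrix.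
   Context: $N$ is a positive integer; the prime denotes matrix transposition. Block rows and columns of $C$ are indexed by $0,1,\ldots,N$, and block tri-diagonality refers to $d\times d$ blocks. A symmetric positive definite block matrix $A=(A_{i,j})_{0\le i,j\le N}$ is called $CM_N$ (also $CM_L$) if $A_{i,j}=0$ whenever $i,j\in\{0,\ldots,N-1\}$ and $|i-j|\ge2$ (block tri-diagonal except for an arbitrary last block row and column). It is called $CM_0$ (also $CM_F$) if $A_{i,j}=0$ whenever $i,j\in\{1,\ldots,N\}$ and $|i-j|\ge2$ (block tri-diagonal except for an arbitrary first block row and column). *)

(* Defs.v *)
From mathcomp Require Import all_boot all_order all_algebra.

Set Implicit Arguments.
Unset Strict Implicit.
Unset Printing Implicit Defensive.

Import Order.TTheory GRing.Theory Num.Theory.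
Local Open Scope ring_scope.

(* Symmetry is part of positive definiteness. *)
Definition posdefmx (R : realFieldType) (n : nat) (A : 'M[R]_n) : Prop :=
  A^T = A /\ forall x : 'cV[R]_n, x != 0 -> 0 < (x^T *m A *m x) 0 0.

(* The size m * d, in the form used by the library for block matrices, so that *)
(* [submxblock] and [submxcol] apply to matrices of this size.                 *)
Notation bdim m d := (\sum_(i < m) d)%N.

Definition blk (R : realFieldType) (m d : nat) (A : 'M[R]_(bdim m d))
    (i j : 'I_m) : 'M[R]_d :=
  @submxblock R m m (fun=> d) (fun=> d) A i j.

(* |i - j| >= 2 *)
Definition far (i j : nat) : bool := (i.+2 <= j)%N || (j.+2 <= i)%N.

Definition block_tridiag (R : realFieldType) (m d : nat)
    (A : 'M[R]_(bdim m d)) : Prop :=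
  forall i j : 'I_m, far i j -> blk A i j = 0.

Definition CM_L (R : realFieldType) (N d : nat)
    (A : 'M[R]_(bdim N.+1 d)) : Prop :=
  posdefmx A /\
  forall i j : 'I_N.+1, (i < N)%N -> (j < N)%N -> far i j -> blk A i j = 0.

Definition CM_F (R : realFieldType) (N d : nat)
    (A : 'M[R]_(bdim N.+1 d)) : Prop :=
  posdefmx A /\
  forall i j : 'I_N.+1, (0 < i)%N -> (0 < j)%N -> far i j -> blk A i j = 0.

(* CM_c for c in {0, N}; False for every other c. *)
Definition CM (R : realFieldType) (N d c : nat)
    (A : 'M[R]_(bdim N.+1 d)) : Prop :=
  (c = N /\ CM_L A) \/ (c = 0%N /\ CM_F A).

(* (N + 1) d written as N d + d (distinguished block last) and as d + N d      *)
(* (distinguished block first); the casts below only transport along these.    *)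
Lemma bdim_last (N d : nat) : (bdim N d + d)%N = bdim N.+1 d.
Proof. by rewrite big_ord_recr. Qed.

Lemma bdim_first (N d : nat) : (d + bdim N d)%N = bdim N.+1 d.
Proof. by rewrite big_ord_recl. Qed.

Definition B_last (R : realFieldType) (N d : nat) (B1 : 'M[R]_(bdim N d)) :
    'M[R]_(bdim N.+1 d) :=
  castmx (bdim_last N d, bdim_last N d) (block_mx B1 0 0 0).

Definition G_last (R : realFieldType) (N d : nat) (S : 'M[R]_(bdim N d, d)) :
    'M[R]_(bdim N.+1 d, d) :=
  castmx (bdim_last N d, erefl d) (col_mx S 1%:M).

Definition B_first (R : realFieldType) (N d : nat) (B1 : 'M[R]_(bdim N d)) :
    'M[R]_(bdim N.+1 d) :=
  castmx (bdim_first N d, bdim_first N d) (block_mx 0 0 0 B1).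

Definition G_first (R : realFieldType) (N d : nat) (S : 'M[R]_(bdim N d, d)) :
    'M[R]_(bdim N.+1 d, d) :=
  castmx (bdim_first N d, erefl d) (col_mx 1%:M S).

(* [invmx B1] is a junk value when B1 is singular, hence B1 \in unitmx. *)
Definition BG_form (R : realFieldType) (N d c : nat)
    (B : 'M[R]_(bdim N.+1 d)) (G : 'M[R]_(bdim N.+1 d, d)) : Prop :=
  exists (B1 : 'M[R]_(bdim N d)) (S : 'M[R]_(bdim N d, d)),
    [/\ B1 \in unitmx, block_tridiag (invmx B1)
      & (c = N /\ B = B_last B1 /\ G = G_last S) \/
        (c = 0%N /\ B = B_first B1 /\ G = G_first S)].

(* Main.v *)
Require Import Defs.
From mathcomp Require Import all_boot all_order all_algebra.

Set Implicit Arguments.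
Unset Strict Implicit.
Unset Printing Implicit Defensive.

Import Order.TTheory GRing.Theory Num.Theory.
Local Open Scope ring_scope.

(* Let the columns of E be the basis vectors of the N undistinguished blocks   *)
(* and those of F the basis vectors of the distinguished one, so that the      *)
(* decomposition reads C = E B1 E' + G D G' with G = E S + F. Since            *)
(* G' (E - F S') = 0, it gives C (E - F S') = E B1, hence                      *)
(* (E' C^-1 E) B1 = 1: the undistinguished part of C^-1 is B1^-1. Conversely,  *)
(* any positive definite C is so decomposed, with D = F' C F, S = E' C F D^-1  *)
(* and B1 the Schur complement E' C E - S D S'. The cases c = N and c = 0 only *)
(* differ in the choice of (E, F).                                             *)

(** The decomposition is block elimination of the distinguished block, and its [B1] is forced: it
    inverts the compression [E^T *m invmx C *m E]. So [frame_decompP] holds for an arbitrary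
    property [P] of that compression, combining existence ([frame_decomp_exists]) with uniqueness of
    [B1] ([frame_decomp_inv]). Block tri-diagonality enters only as the choice of [P];
    [CM_L_block_tridiag] and [CM_F_block_tridiag] translate it back to the blocks of the full
    matrix. *)

Lemma posdefmx_unit (R : realFieldType) n (A : 'M[R]_n) :
  posdefmx A -> A \in unitmx.
Proof.
case=> _ Apos; rewrite -row_free_unit -kermx_eq0; apply/rowV0P => v.
move=> /sub_kermxP vA0; apply/eqP/negPn/negP => v_neq0.
have := Apos v^T; rewrite trmx_eq0 => /(_ v_neq0).
by rewrite trmxK vA0 mul0mx mxE ltxx.
Qed.

Lemma posdefmx_congr (R : realFieldType) m n (A : 'M[R]_n) (E : 'M[R]_(n, m)) :
    (forall x : 'cV[R]_m, E *m x = 0 -> x = 0) ->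
  posdefmx A -> posdefmx (E^T *m A *m E).
Proof.
move=> injE [Asym Apos]; split; first by rewrite !trmx_mul trmxK Asym mulmxA.
move=> x x_neq0; have /Apos : E *m x != 0.
  by apply: contra_neq x_neq0; apply: injE.
by rewrite trmx_mul !mulmxA.
Qed.

Lemma posdefmx_inv (R : realFieldType) n (A : 'M[R]_n) :
  posdefmx A -> posdefmx (invmx A).
Proof.
move=> Apd; have Au := posdefmx_unit Apd; have [Asym _] := Apd.
(* The inverse is congruent to [A] through the injective matrix [invmx A]. *)
have -> : invmx A = (invmx A)^T *m A *m invmx A.
  by rewrite -mulmxA mulmxV // mulmx1 trmx_inv Asym.
apply: posdefmx_congr Apd => x /(congr1 (mulmx A)).
by rewrite mulKVmx // mulmx0.
Qed.

(** That is, the matrix with column blocks [E] and [F] is orthogonal. Avoiding coordinates lets one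
    argument serve both positions of the distinguished block. *)
Definition orthoframe (R : realFieldType) n m d
    (E : 'M[R]_(n, m)) (F : 'M[R]_(n, d)) : Prop :=
  [/\ E^T *m E = 1%:M, E^T *m F = 0, F^T *m F = 1%:M
    & E *m E^T + F *m F^T = 1%:M].

Section Frame.

Variables (R : realFieldType) (n m d : nat).
Variables (E : 'M[R]_(n, m)) (F : 'M[R]_(n, d)).
Hypothesis frameEF : orthoframe E F.

Let EE : E^T *m E = 1%:M. Proof. by case: frameEF. Qed.
Let EF : E^T *m F = 0. Proof. by case: frameEF. Qed.
Let FF : F^T *m F = 1%:M. Proof. by case: frameEF. Qed.
Let EEFF : E *m E^T + F *m F^T = 1%:M. Proof. by case: frameEF. Qed.
Let FE : F^T *m E = 0.
Proof. by rewrite -[LHS]trmxK trmx_mul trmxK EF trmx0. Qed.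

Let ET S : E^T *m (E - F *m S^T) = 1%:M.
Proof. by rewrite mulmxBr mulmxA EE EF mul0mx subr0. Qed.
Let FT S : F^T *m (E - F *m S^T) = - S^T.
Proof. by rewrite mulmxBr mulmxA FE FF mul1mx sub0r. Qed.

Lemma frame_decomp_inv (C : 'M[R]_n) (D : 'M[R]_d) (B1 : 'M[R]_m)
    (S : 'M[R]_(m, d)) :
    C \in unitmx ->
    C = E *m B1 *m E^T + (E *m S + F) *m D *m (E *m S + F)^T ->
  B1 \in unitmx /\ invmx B1 = E^T *m invmx C *m E.
Proof.
move=> Cu defC.
have GT0 : (E *m S + F)^T *m (E - F *m S^T) = 0.
  by rewrite [(_ + F)^T]linearD /= trmx_mul mulmxDl -mulmxA ET FT mulmx1 subrr.
have CT : C *m (E - F *m S^T) = E *m B1.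
  by rewrite defC mulmxDl -2!(mulmxA _ _ (E - F *m S^T)) ET GT0 mulmx1 mulmx0 addr0.
(* By [CT], [invmx C *m E *m B1] is [E - F *m S^T], whose compression by [E^T] is the identity. *)
have invB1 : E^T *m invmx C *m E *m B1 = 1%:M.
  by rewrite -mulmxA -CT mulmxA mulmxKV // ET.
have [_ B1u] := mulmx1_unit invB1; split=> //.
by rewrite -[RHS](mulmxK B1u) invB1 mul1mx.
Qed.

Lemma frame_decomp_exists (C : 'M[R]_n) : posdefmx C ->
  exists (D : 'M[R]_d) (B1 : 'M[R]_m) (S : 'M[R]_(m, d)),
    posdefmx D /\ C = E *m B1 *m E^T + (E *m S + F) *m D *m (E *m S + F)^T.
Proof.
move=> Cpd; pose D := F^T *m C *m F.
have Dpd : posdefmx D.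
  apply: posdefmx_congr Cpd => x Fx0.
  by rewrite -[x]mul1mx -FF -mulmxA Fx0 mulmx0.
have Du := posdefmx_unit Dpd; have [Dsym _] := Dpd; have [Csym _] := Cpd.
have [S SD] : exists S, S *m D = E^T *m C *m F.
  by exists (E^T *m C *m F *m invmx D); rewrite mulmxKV.
(* This [B1] is the Schur complement of [D], as [E^T *m C *m F] equals [S *m D]. *)
exists D, (E^T *m C *m (E - F *m S^T)), S; split=> //.
have DS : D *m S^T = F^T *m C *m E.
  by rewrite -[D in LHS]Dsym -trmx_mul SD !trmx_mul trmxK Csym mulmxA.
have GD : (E *m S + F) *m D = C *m F.
  by rewrite mulmxDl -mulmxA SD !mulmxA -!mulmxDl EEFF mul1mx.
have FCT : F^T *m C *m (E - F *m S^T) = 0.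
  by rewrite mulmxBr mulmxA -/D DS subrr.
(* By [FCT] these columns have no component along [F], so projecting onto the range of [E] fixes
   them. *)
have EB : E *m (E^T *m C *m (E - F *m S^T)) = C *m (E - F *m S^T).
  rewrite -[RHS]mul1mx -EEFF [RHS]mulmxDl -!mulmxA [F^T *m _]mulmxA FCT.
  by rewrite mulmx0 addr0.
(* With [C] factored out, the terms in [F *m S^T *m E^T] cancel and [EEFF] remains. *)
rewrite EB GD -!mulmxA -mulmxDr [(_ + F)^T]linearD /= trmx_mul.
by rewrite mulmxBl [F *m (_ + _)]mulmxDr !mulmxA addrA subrK EEFF mulmx1.
Qed.

Lemma frame_decompP (C : 'M[R]_n) (P : 'M[R]_m -> Prop) : posdefmx C ->
  P (E^T *m invmx C *m E) <->
  exists (D : 'M[R]_d) (B1 : 'M[R]_m) (S : 'M[R]_(m, d)),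
    [/\ posdefmx D, B1 \in unitmx, P (invmx B1)
      & C = E *m B1 *m E^T + (E *m S + F) *m D *m (E *m S + F)^T].
Proof.
move=> Cpd; have Cu := posdefmx_unit Cpd; split=> [PE | [D [B1 [S]]]].
  have [D [B1 [S [Dpd defC]]]] := frame_decomp_exists Cpd.
  have [B1u invB1] := frame_decomp_inv Cu defC.
  by exists D, B1, S; split=> //; rewrite invB1.
by case=> _ _ PB1 /(frame_decomp_inv Cu)[_ <-].
Qed.

End Frame.

Section Frames.

Variable R : realFieldType.

(** The size [n] is a variable tied to [m + d] by [e], so that case analysis on [e] removes the
    cast. *)
Definition basis_l m d n (e : (m + d)%N = n) : 'M[R]_(n, m) :=
  castmx (e, erefl m) (col_mx 1%:M 0).

Definition basis_r m d n (e : (m + d)%N = n) : 'M[R]_(n, d) :=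
  castmx (e, erefl d) (col_mx 0 1%:M).

Lemma basis_orthoframe m d n (e : (m + d)%N = n) :
  orthoframe (basis_l e) (basis_r e).
Proof.
case: n / e; rewrite /basis_l /basis_r !castmx_id.
split; rewrite !tr_col_mx ?mul_row_col ?mul_col_row !(trmx0, trmx1);
  rewrite ?(mulmx0, mul0mx, mulmx1, mul1mx, addr0, add0r) //.
by rewrite add_block_mx !(addr0, add0r) -scalar_mx_block.
Qed.

Lemma orthoframeC n m d (E : 'M[R]_(n, m)) (F : 'M[R]_(n, d)) :
  orthoframe E F -> orthoframe F E.
Proof.
case=> EE EF FF EEFF; split; rewrite // 1?addrC //.
by rewrite -[LHS]trmxK trmx_mul trmxK EF trmx0.
Qed.

Lemma basis_l_sandwich m d n (e : (m + d)%N = n) (A : 'M[R]_n) i j :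
  ((basis_l e)^T *m A *m basis_l e) i j
    = A (cast_ord e (lshift d i)) (cast_ord e (lshift d j)).
Proof.
case: n / e A => A; rewrite /basis_l castmx_id !cast_ord_id.
rewrite -[A in LHS]submxK tr_col_mx trmx0 trmx1 mul_row_block mul_row_col.
by rewrite !(mul0mx, mulmx0, mul1mx, mulmx1, addr0) !mxE.
Qed.

Lemma basis_r_sandwich m d n (e : (m + d)%N = n) (A : 'M[R]_n) i j :
  ((basis_r e)^T *m A *m basis_r e) i j
    = A (cast_ord e (rshift m i)) (cast_ord e (rshift m j)).
Proof.
case: n / e A => A; rewrite /basis_r castmx_id !cast_ord_id.
rewrite -[A in LHS]submxK tr_col_mx trmx0 trmx1 mul_row_block mul_row_col.
by rewrite !(mul0mx, mulmx0, mul1mx, mulmx1, add0r) !mxE.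
Qed.

Lemma B_lastE N d (B1 : 'M[R]_(bdim N d)) :
  B_last B1 = basis_l (bdim_last N d) *m B1 *m (basis_l (bdim_last N d))^T.
Proof.
rewrite /B_last /basis_l; case: _ / (bdim_last N d); rewrite !castmx_id.
rewrite tr_col_mx trmx1 trmx0 mul_col_mx mul_col_row.
by rewrite !(mul1mx, mulmx1, mul0mx, mulmx0).
Qed.

Lemma B_firstE N d (B1 : 'M[R]_(bdim N d)) :
  B_first B1 = basis_r (bdim_first N d) *m B1 *m (basis_r (bdim_first N d))^T.
Proof.
rewrite /B_first /basis_r; case: _ / (bdim_first N d); rewrite !castmx_id.
rewrite tr_col_mx trmx1 trmx0 mul_col_mx mul_col_row.
by rewrite !(mul1mx, mulmx1, mul0mx, mulmx0).
Qed.

Lemma G_lastE N d (S : 'M[R]_(bdim N d, d)) :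
  G_last S = basis_l (bdim_last N d) *m S + basis_r (bdim_last N d).
Proof.
rewrite /G_last /basis_l /basis_r; case: _ / (bdim_last N d).
by rewrite !castmx_id mul_col_mx mul1mx mul0mx add_col_mx addr0 add0r.
Qed.

Lemma G_firstE N d (S : 'M[R]_(bdim N d, d)) :
  G_first S = basis_r (bdim_first N d) *m S + basis_l (bdim_first N d).
Proof.
rewrite /G_first /basis_l /basis_r; case: _ / (bdim_first N d).
by rewrite !castmx_id mul_col_mx mul1mx mul0mx add_col_mx addr0 add0r.
Qed.

End Frames.

(** [tagnat.Rank] is the flat index behind [submxblock]; the [i] preceding blocks all have size
    [d]. *)
Lemma val_Rank_const n d (i : 'I_n) (k : 'I_d) :
  tagnat.Rank (p_ := fun=> d) i k = (i * d + k)%N :> nat.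
Proof.
rewrite tagnat.RankEsum -(big_ord_widen n (fun=> d) (ltnW (ltn_ord i))).
by rewrite sum_nat_const card_ord.
Qed.

Lemma cast_lshift_Rank N d (i : 'I_N) (k : 'I_d) :
  cast_ord (bdim_last N d) (lshift d (tagnat.Rank (p_ := fun=> d) i k))
    = tagnat.Rank (p_ := fun=> d) (widen_ord (leqnSn N) i) k.
Proof.
apply: val_inj; apply: etrans (val_Rank_const i k) _.
exact/esym/(val_Rank_const (widen_ord (leqnSn N) i)).
Qed.

Lemma cast_rshift_Rank N d (i : 'I_N) (k : 'I_d) :
  cast_ord (bdim_first N d) (rshift d (tagnat.Rank (p_ := fun=> d) i k))
    = tagnat.Rank (p_ := fun=> d) (lift ord0 i) k.
Proof.
apply: val_inj; apply: etrans (congr1 (addn d) (val_Rank_const i k)) _.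
by rewrite addnA -mulSn; exact/esym/(val_Rank_const (lift ord0 i)).
Qed.

Lemma blk_last (R : realFieldType) N d (A : 'M[R]_(bdim N.+1 d)) (i j : 'I_N) :
  blk ((basis_l R (bdim_last N d))^T *m A *m basis_l R (bdim_last N d)) i j
    = blk A (widen_ord (leqnSn N) i) (widen_ord (leqnSn N) j).
Proof.
apply/matrixP=> k l; rewrite [LHS]mxE [RHS]mxE basis_l_sandwich.
by rewrite !cast_lshift_Rank.
Qed.

Lemma blk_first (R : realFieldType) N d (A : 'M[R]_(bdim N.+1 d)) (i j : 'I_N) :
  blk ((basis_r R (bdim_first N d))^T *m A *m basis_r R (bdim_first N d)) i j
    = blk A (lift ord0 i) (lift ord0 j).
Proof.
apply/matrixP=> k l; rewrite [LHS]mxE [RHS]mxE basis_r_sandwich.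
by rewrite !cast_rshift_Rank.
Qed.

Lemma CM_L_block_tridiag (R : realFieldType) N d (A : 'M[R]_(bdim N.+1 d)) :
    posdefmx A ->
  CM_L A <->
  block_tridiag ((basis_l R (bdim_last N d))^T *m A *m basis_l R (bdim_last N d)).
Proof.
move=> Apd; split=> [[_ tri] i j ij_far | tri].
  by rewrite blk_last; apply: tri => /=.
split=> // i j iN jN ij_far.
have := tri (Ordinal iN) (Ordinal jN) ij_far; rewrite blk_last => <-.
by congr (blk A _ _); apply: val_inj.
Qed.

Lemma CM_F_block_tridiag (R : realFieldType) N d (A : 'M[R]_(bdim N.+1 d)) :
    posdefmx A ->
  CM_F A <->
  block_tridiag
    ((basis_r R (bdim_first N d))^T *m A *m basis_r R (bdim_first N d)).
Proof.
move=> Apd; split=> [[_ tri] i j ij_far | tri].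
  by rewrite blk_first; apply: tri.
(* A nonzero index is a lift of some [i']; lifting shifts both indices by one, which preserves
   [far]. *)
split=> // i j; case: (unliftP ord0 i) => [i' ->|-> //] _.
case: (unliftP ord0 j) => [j' ->|-> //] _ ij_far.
by rewrite -blk_first; apply: tri.
Qed.

Theorem corollary4p2 (R : realFieldType) (N d c : nat)
    (hN : (0 < N)%N) (hd : (0 < d)%N) (hc : c = 0%N \/ c = N)
    (C : 'M[R]_(bdim N.+1 d)) (hC : posdefmx C) :
  CM c (invmx C) <->
  exists (D : 'M[R]_d) (B : 'M[R]_(bdim N.+1 d)) (G : 'M[R]_(bdim N.+1 d, d)),
    [/\ posdefmx D, BG_form c B G & C = B + G *m D *m G^T].
Proof.
have Ipd := posdefmx_inv hC.
have frL := basis_orthoframe R (bdim_last N d).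
(* With the distinguished block first, [basis_r] plays [E] and [basis_l] plays [F]. *)
have frF := orthoframeC (basis_orthoframe R (bdim_first N d)).
have eqL := frame_decompP frL (@block_tridiag R N d) hC.
have eqF := frame_decompP frF (@block_tridiag R N d) hC.
split=> [[] [->] | [D [B [G [Dpd]]]]].
- move/(CM_L_block_tridiag Ipd)/eqL => [D [B1 [S [Dpd B1u tri defC]]]].
  exists D, (B_last B1), (G_last S); split; rewrite ?B_lastE ?G_lastE //.
  by exists B1, S; split=> //; left; rewrite B_lastE G_lastE.
- move/(CM_F_block_tridiag Ipd)/eqF => [D [B1 [S [Dpd B1u tri defC]]]].
  exists D, (B_first B1), (G_first S); split; rewrite ?B_firstE ?G_firstE //.
  by exists B1, S; split=> //; right; rewrite B_firstE G_firstE.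
case=> B1 [S [B1u tri [] [-> [-> ->]]]] defC.
- left; split=> //; apply/(CM_L_block_tridiag Ipd)/eqL.
  by exists D, B1, S; split=> //; rewrite -B_lastE -G_lastE.
- right; split=> //; apply/(CM_F_block_tridiag Ipd)/eqF.
  by exists D, B1, S; split=> //; rewrite -B_firstE -G_firstE.
Qed.
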